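(* Let $m\in\mathbb{N}$, and let $\mathbf p=(p_1,\dots,p_m)\in[0,1]^m$ and $\mathbf p'=(p'_1,\dots,p'_m)\in[0,1]^m$ be such that $\mathbf p$ majorizes $\mathbf p'$ (i.e. $\mathbf p\succ\mathbf p'$). Then $$B(1,p_1)*\dots*B(1,p_m)\leq_{\mathrm{cx}}B(1,p'_1)*\dots*B(1,p'_m).$$
   Context: Majorization: for $\mathbf p=(p_1,\dots,p_m),\mathbf q=(q_1,\dots,q_m)\in\mathbb{R}^m$, one says that $\mathbf q$ majorizes $\mathbf p$ (written $\mathbf p\prec\mathbf q$ or $\mathbf q\succ\mathbf p$) if (i) $\sum_{l=1}^m\widehat p_l=\sum_{l=1}^m\widehat q_l$ and (ii) $\sum_{l=1}^k\widehat p_l\leq\sum_{l=1}^k\widehat q_l$ for $k=1,\dots,m$, where $\widehat p_1\geq\dots\geq\widehat p_m$ and $\widehat q_1\geq\dots\geq\widehat q_m$ are the nonincreasing rearrangements of $\mathbf p$ and $\mathbf q$, respectively. $B(1,p)$ denotes the Bernoulli distribution on $\mathbb{R}$ with parameter $p\in[0,1]$, i.e. $B(1,p)(\{1\})=p$ and $B(1,p)(\{0\})=1-p$. The symbol $*$ denotes convolution of probability distributions. Convex stochastic order: for probability distributions $\mu,\nu$ on $\mathbb{R}$, $\mu\leq_{\mathrm{cx}}\nu$ means that $\int\varphi(x)\,\mu(dx)\leq\int\varphi(x)\,\nu(dx)$ for all convex functions $\varphi:\mathbb{R}\to\mathbb{R}$, provided the integrals exist. *)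

(* Defs.v *)
From HB Require Import structures.
From mathcomp Require Import all_boot all_order all_algebra.
From mathcomp Require Import all_classical all_reals all_analysis.
From mathcomp Require Import measurable_realfun.

Set Implicit Arguments.
Unset Strict Implicit.
Unset Printing Implicit Defensive.

Import Order.TTheory GRing.Theory Num.Theory.
Import numFieldNormedType.Exports.

Local Open Scope classical_set_scope.
Local Open Scope ring_scope.

(* [majorizes q p] is p \prec q; [sort >=%R] is the nonincreasing
   rearrangement. *)
Definition majorizes {R : realType} (m : nat) (q p : m.-tuple R) : Prop :=
  \sum_(l < m) (sort >=%R p)`_l = \sum_(l < m) (sort >=%R q)`_l /\
  forall k : nat, (1 <= k <= m)%N ->
    \sum_(l < k) (sort >=%R p)`_l <= \sum_(l < k) (sort >=%R q)`_l.

Section laws.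
Context {R : realType}.
Local Notation law := (probability (measurableTypeR R) R).

Definition bool_real (b : bool) : measurableTypeR R := b%:R.

Lemma measurable_bool_real : measurable_fun [set: bool] bool_real.
Proof. by []. Qed.

HB.instance Definition _ :=
  isMeasurableFun.Build _ _ _ _ bool_real measurable_bool_real.

(* [bernoulli_prob p] is a law on [bool], the Dirac mass at [false] when p is
   not in [0, 1]. *)
Definition bernoulliR (p : R) : law :=
  distribution (bernoulli_prob p) bool_real.

Lemma bernoulliR_set1 (p : R) : 0 <= p <= 1 ->
  bernoulliR p [set (1 : R)] = p%:E.
Proof.
move=> p01; rewrite /bernoulliR /distribution /pushforward/= bernoulli_probE//.
rewrite !diracE mem_set// memNset ?mule0 ?adde0 ?mule1//.
by rewrite /bool_real/= => /esym/eqP; rewrite oner_eq0.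
Qed.

Lemma bernoulliR_set0 (p : R) : 0 <= p <= 1 ->
  bernoulliR p [set (0 : R)] = (1 - p)%:E.
Proof.
move=> p01; rewrite /bernoulliR /distribution /pushforward/= bernoulli_probE//.
rewrite !diracE memNset ?mem_set ?mule0 ?add0e ?mule1//.
by rewrite /bool_real/= => /eqP; rewrite oner_eq0.
Qed.

Definition sumR (xy : measurableTypeR R * measurableTypeR R) :
  measurableTypeR R := (xy.1 : R) + xy.2.

Lemma measurable_sumR : measurable_fun setT sumR.
Proof.
by apply: (@measurable_funD _ _ R);
  [exact: measurable_fst|exact: measurable_snd].
Qed.

HB.instance Definition _ :=
  isMeasurableFun.Build _ _ _ _ sumR measurable_sumR.

Definition convolution (mu nu : law) : law := distribution (mu \x nu)%E sumR.

(* The empty convolution, neutral for [convolution]. *)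
Definition dirac_zero : law := \d_(0 : measurableTypeR R).

Lemma convolution_unit (mu : law) (A : set R) :
  measurable (A : set (measurableTypeR R)) -> convolution mu dirac_zero A = mu A.
Proof.
move=> mA; rewrite /convolution /distribution /pushforward/=.
rewrite /product_measure1/= -[in RHS](setIT A) -integral_indic//.
apply: eq_integral => x _; rewrite /dirac_zero/= diracE indicE.
suff -> : 0 \in xsection (sumR @^-1` A) x = (x \in A) by [].
rewrite mem_xsection; apply: asbool_equiv_eq.
by rewrite /preimage/= /sumR/= addr0.
Qed.

(* The integral exists in the extended sense: it may be infinite, but is not
   of the form oo - oo. *)
Definition integral_exists (mu : law) (f : R -> \bar R) : Prop :=
  measurable_fun [set: measurableTypeR R] f /\
  ((\int[mu]_x f^\+ x < +oo)%E \/ (\int[mu]_x f^\- x < +oo)%E).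

Definition cx_le (mu nu : law) : Prop :=
  forall phi : R -> R,
    convex_function [set: R^o] phi ->
    integral_exists mu (EFin \o phi) -> integral_exists nu (EFin \o phi) ->
    (\int[mu]_x (phi x)%:E <= \int[nu]_x (phi x)%:E)%E.

End laws.

(* Main.v *)
Require Import Defs.
From mathcomp Require Import all_boot all_order all_algebra.
From mathcomp Require Import all_classical all_reals all_analysis.
From mathcomp Require Import measurable_realfun ring lra.

Set Implicit Arguments.
Unset Strict Implicit.
Unset Printing Implicit Defensive.

Import Order.TTheory GRing.Theory Num.Theory.
Import numFieldNormedType.Exports.

Local Open Scope ring_scope.

(* The mean of g(X_1 + ... + X_m), for independent X_i of law B(1, x_i), is a
   symmetric function of the x_i, affine in each of them.  In two of them it
   depends only on the sum and the product, and for convex g it increases with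
   the product.  Hence it increases when mass is moved from a larger parameter
   to a smaller one so as to bring them closer, and if q majorizes p, finitely
   many such transfers lead from q to p. *)

(* Conditioning on the first of independent Bernoulli variables with
   parameters [s], this is the mean of [g] at their sum. *)
Fixpoint bern_mean {R : pzRingType} (s : seq R) (g : nat -> R) : R :=
  if s is x :: s' then x * bern_mean s' (g \o succn) + (1 - x) * bern_mean s' g
  else g 0%N.

(** * Linearity and symmetry of the mean *)

Section bern_mean_linear.
Context {R : comPzRingType}.
Implicit Types (s t : seq R) (g h : nat -> R).

Lemma eq_bern_mean s g h : g =1 h -> bern_mean s g = bern_mean s h.
Proof.
by elim: s g h => [|x s ih] g h gh //=; congr (_ * _ + _ * _); apply: ih => n /=.
Qed.

Lemma bern_meanD s g h : bern_mean s (g \+ h) = bern_mean s g + bern_mean s h.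
Proof.
elim: s g h => [|x s ih] g h //=.
rewrite (@eq_bern_mean s _ ((g \o succn) \+ (h \o succn)))// !ih; ring.
Qed.

Lemma bern_meanN s g : bern_mean s (\- g) = - bern_mean s g.
Proof.
elim: s g => [|x s ih] g //=.
rewrite (@eq_bern_mean s _ (\- (g \o succn)))// !ih; ring.
Qed.

Lemma bern_mean_swap x y s g :
  bern_mean (x :: y :: s) g = bern_mean (y :: x :: s) g.
Proof. by move=> /=; ring. Qed.

Lemma bern_mean_rem x s g :
  x \in s -> bern_mean s g = bern_mean (x :: rem x s) g.
Proof.
elim: s g => // y s ih g; rewrite inE /=; case: (eqVneq y x) => [->//|yx].
by move=> /= xs; rewrite !(ih _ xs) /=; ring.
Qed.

Lemma perm_bern_mean s t g : perm_eq s t -> bern_mean s g = bern_mean t g.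
Proof.
elim: s t g => [|x s ih] t g st.
  by rewrite perm_sym in st; rewrite (perm_nilP st).
have xt : x \in t by rewrite -(perm_mem st) mem_head.
have srem : perm_eq s (rem x t).
  by rewrite -(perm_cons x) (perm_trans st)// perm_to_rem.
by rewrite (bern_mean_rem g xt) /= !(ih _ _ srem).
Qed.

End bern_mean_linear.

(** * Schur concavity of the mean of a convex function *)

Definition discrete_convex {R : numDomainType} (g : nat -> R) :=
  forall n, 0 <= g n.+2 - g n.+1 *+ 2 + g n.

Section schur_concavity.
Context {R : realFieldType}.
Implicit Types (p q s : seq R) (g : nat -> R) (x y d e : R).
Local Notation unit_itv := (fun x : R => 0 <= x <= 1).

Lemma bern_mean_ge0 s g :
  all unit_itv s -> (forall n, 0 <= g n) -> 0 <= bern_mean s g.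
Proof.
elim: s g => [|x s ih] g //= /andP[/andP[x0 x1] s01] g0.
by apply: addr_ge0; apply: mulr_ge0; rewrite ?subr_ge0//; apply: ih => // n /=.
Qed.

(* With [x + y] fixed, the mean is affine in [x * y], with slope the mean of
   the second difference of [g]. *)
Lemma bern_mean_transfer x y x' y' s g : all unit_itv s -> discrete_convex g ->
  x + y = x' + y' -> x * y <= x' * y' ->
  bern_mean (x :: y :: s) g <= bern_mean (x' :: y' :: s) g.
Proof.
move=> s01 cg xy prod.
have : 0 <= bern_mean s (fun n => g n.+2 - g n.+1 *+ 2 + g n).
  exact: bern_mean_ge0.
rewrite (@eq_bern_mean _ s _ ((g \o succn \o succn) \+
   (\- ((g \o succn) \+ (g \o succn))) \+ g)); last first.
  by move=> n /=; rewrite mulr2n.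
rewrite !(bern_meanD, bern_meanN).
set A := bern_mean s (_ \o _ \o _); set B := bern_mean s (g \o succn).
set C := bern_mean s g => ABC /=; rewrite -/A -/B -/C.
have y'E : y' = x + y - x' by rewrite xy; ring.
rewrite -subr_ge0 [leRHS](_ : _ =
  (x' * y' - x * y) * (A - (B + B) + C)); last by rewrite y'E; ring.
by rewrite mulr_ge0// subr_ge0.
Qed.

(* Every prefix sum of [q], increased by [d], is at least that of [p], with
   equality for the full sums. *)
Fixpoint dominates d p q : Prop :=
  match p, q with
  | [::], [::] => d = 0
  | a :: p', b :: q' => 0 <= d + (b - a) /\ dominates (d + (b - a)) p' q'
  | _, _ => False
  end.

Lemma discrete_convex_succ g : discrete_convex g -> discrete_convex (g \o succn).
Proof. by move=> cg n; exact: cg. Qed.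

(** Conditioning on the common variable leaves nonnegative weights on the means of [g \o succn] and
    [g], both convex. *)
Lemma ler_bern_mean_cons x s s' : 0 <= x <= 1 ->
  (forall g, discrete_convex g -> bern_mean s g <= bern_mean s' g) ->
  forall g, discrete_convex g -> bern_mean (x :: s) g <= bern_mean (x :: s') g.
Proof.
move=> /andP[x0 x1] ss' g cg /=.
by rewrite lerD// ler_wpM2l ?subr_ge0// ss'//; exact: discrete_convex_succ.
Qed.

(* The excess [d] of the head is passed on to the entries of [q] that lie below
   those of [p], the part [e] of the slack being kept. *)
Lemma absorb_excess x d e p q : 0 <= d -> 0 <= e -> 0 <= x <= 1 ->
  all unit_itv p -> all unit_itv q -> all (<= x) p ->
  dominates (e + d) p q ->
  exists q', [/\ all unit_itv q', dominates e p q' &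
    forall g, discrete_convex g ->
      bern_mean ((x + d) :: q) g <= bern_mean (x :: q') g].
Proof.
move=> d0 e0 x01; elim: p q d e d0 e0 => [|a p ih] [|b q] // d e d0 e0.
  move=> _ _ _ /= ed0; exists [::]; have [-> ->] : d = 0 /\ e = 0 by split; lra.
  by split=> // g _; rewrite addr0.
rewrite 3![all _ (_ :: _)]/= [dominates _ _ _]/=.
move=> /andP[a01 p01] /andP[b01 q01] /andP[ax px] [edba dom].
(* An entry [b] not below [a] is left alone: its surplus [b - a] joins the kept slack [e], and the
   head is swapped past it. *)
have [ab|ba] := leP a b.
  have eba : 0 <= e + (b - a) by lra.
  have := ih q d (e + (b - a)) d0 eba p01 q01 px.
  rewrite addrAC => /(_ dom)[q' [q'01 dom' le']].
  exists (b :: q'); split; [by rewrite /= b01|by []|].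
  move=> g cg; rewrite bern_mean_swap (bern_mean_swap x).
  exact: ler_bern_mean_cons.
(* If the deficit [a - b] can hold all of [d], one transfer suffices. It raises the product by
   [d * (x - b)], where [b < a <= x]. *)
have [dab|abd] := leP d (a - b).
  exists (b + d :: q); split.
  - rewrite /= q01 andbT; move: a01 b01 => /andP[? ?] /andP[? ?].
    by apply/andP; split; lra.
  - by rewrite /= (_ : e + (b + d - a) = e + d + (b - a)); last ring.
  - move=> g cg; apply: bern_mean_transfer => //; first ring.
    have : 0 <= d * (x - b) by rewrite mulr_ge0//; lra.
    by lra.
(* Otherwise [b] is filled up to [a], and the remaining excess [d - (a - b)] stays at the head for
   the later entries. *)
have dab0 : 0 <= d - (a - b) by lra.
have := ih q (d - (a - b)) e dab0 e0 p01 q01 px.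
rewrite (_ : e + (d - (a - b)) = e + d + (b - a)); last ring.
move=> /(_ dom)[q' [q'01 dom' le']].
exists (a :: q'); split; [by rewrite /= a01|by rewrite /= subrr addr0|].
move=> g cg; apply: (@le_trans _ _ (bern_mean (x + (d - (a - b)) :: a :: q) g)).
  apply: bern_mean_transfer => //; first ring.
  have : 0 <= (a - b) * (x + (d - (a - b)) - b) by rewrite mulr_ge0//; lra.
  by lra.
rewrite bern_mean_swap (bern_mean_swap x); exact: ler_bern_mean_cons.
Qed.

(** As [p] is sorted, its head [x] bounds its tail, so the excess [y - x] can be absorbed with slack
    0. The heads then agree, and induction handles the tails. *)
Lemma ler_bern_mean_dominates p q : all unit_itv p -> all unit_itv q ->
  sorted >=%R p -> dominates 0 p q ->
  forall g, discrete_convex g -> bern_mean q g <= bern_mean p g.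
Proof.
elim: p q => [|x p ih] [|y q] //= /andP[x01 p01] /andP[y01 q01] xp.
rewrite add0r => -[xy dom] g cg.
have px : all (<= x) p by rewrite (order_path_min _ xp)//; exact: ge_trans.
have := @absorb_excess x (y - x) 0 p q xy (lexx _) x01 p01 q01 px.
rewrite add0r => /(_ dom)[q' [q'01 dom' le']].
apply: (@le_trans _ _ (bern_mean (x :: q') g)).
  by have := le' _ cg; rewrite addrC subrK.
apply: (ler_bern_mean_cons x01) cg => h ch.
exact: (ih _ p01 q'01 (path_sorted xp)).
Qed.

Lemma dominates_prefix_sums d p q : size p = size q ->
  d + \sum_(l < size p) q`_l = \sum_(l < size p) p`_l ->
  (forall k, (1 <= k <= size p)%N ->
     \sum_(l < k) p`_l <= d + \sum_(l < k) q`_l) ->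
  dominates d p q.
Proof.
elim: p q d => [|a p ih] [|b q] d //=; first by rewrite !big_ord0 addr0.
move=> [pq] tot pre; split.
  by have := pre 1%N isT; rewrite !big_ord_recl !big_ord0/=; lra.
apply: ih => //.
  by move: tot; rewrite !big_ord_recl/=; lra.
(* A prefix of length [k] of the tails is one of length [k.+1] of the lists, the gap of the heads
   having moved into [d]. *)
move=> k /andP[_ kp]; have := pre k.+1 kp.
by rewrite !big_ord_recl/=; lra.
Qed.

End schur_concavity.

(** By symmetry both tuples may be sorted; majorization then becomes domination with initial slack
    0. *)
Lemma ler_bern_mean_majorizes (R : realType) (m : nat) (p q : m.-tuple R) g :
  all (fun x => 0 <= x <= 1) p -> all (fun x => 0 <= x <= 1) q ->
  majorizes q p -> discrete_convex g ->
  bern_mean q g <= bern_mean p g.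
Proof.
move=> p01 q01 [tot pre] cg.
rewrite -(perm_bern_mean g (permEl (perm_sort >=%R p))).
rewrite -(perm_bern_mean g (permEl (perm_sort >=%R q))).
apply: ler_bern_mean_dominates cg; rewrite ?all_sort//.
  exact/sort_sorted/ge_total.
apply: dominates_prefix_sums; rewrite !size_sort ?size_tuple ?add0r//.
by move=> k km; rewrite add0r; exact: pre.
Qed.

(** * Integrals against convolutions of Bernoulli laws *)

Section convolution_integral.
Context {R : realType}.
Local Notation law := (probability (measurableTypeR R) R).

Lemma ge0_integral_bernoulliR (p : R) (f : R -> R) : 0 <= p <= 1 ->
  measurable_fun [set: measurableTypeR R] f -> (forall x, 0 <= f x) ->
  (\int[bernoulliR p]_x (f x)%:E = (p * f 1 + (1 - p) * f 0)%:E)%E.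
Proof.
move=> p01 mf f0; rewrite ge0_integral_distribution; last 2 first.
- exact/measurable_EFinP.
- by move=> y; rewrite lee_fin.
by rewrite integral_bernoulli_prob// => b; rewrite lee_fin.
Qed.

Lemma ge0_integral_convolution (mu nu : law) (f : R -> R) :
  measurable_fun [set: measurableTypeR R] f -> (forall x, 0 <= f x) ->
  (\int[convolution mu nu]_z (f z)%:E =
   \int[mu]_x \int[nu]_y (f (x + y))%:E)%E.
Proof.
move=> mf f0; rewrite ge0_integral_distribution; last 2 first.
- exact/measurable_EFinP.
- by move=> y; rewrite lee_fin.
rewrite fubini_tonelli1//.
- apply/measurable_EFinP; apply: measurableT_comp => //; exact: measurable_sumR.
- by move=> x; rewrite lee_fin.
Qed.

(** Serves to integrate the inner mean over the first summand [a]. The shift [h] is arbitrary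
    because the recursion replaces it by [h \o succn]. *)
Lemma measurable_bern_mean (s : seq R) (h : nat -> R) (f : R -> R) :
  measurable_fun [set: measurableTypeR R] f ->
  measurable_fun [set: measurableTypeR R]
    (fun a => bern_mean s (fun n => f (a + h n))).
Proof.
move=> mf; elim: s h => [|y s ih] h /=.
  by apply: measurableT_comp => //; exact: measurable_funD.
apply: measurable_funD; apply: measurable_funM => //.
exact: (ih (h \o succn)).
Qed.

Lemma ge0_integral_bern_mean (s : seq R) (f : R -> R) :
  all (fun x => 0 <= x <= 1) s ->
  measurable_fun [set: measurableTypeR R] f -> (forall x, 0 <= f x) ->
  (\int[\big[convolution/dirac_zero]_(x <- s) bernoulliR x]_z (f z)%:E =
   (bern_mean s (fun n => f n%:R))%:E)%E.
Proof.
elim: s f => [|x s ih] f.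
  move=> _ mf f0; rewrite big_nil integral_dirac//=; last exact/measurable_EFinP.
  by rewrite diracT mul1e.
move=> /= /andP[x01 s01] mf f0; rewrite big_cons ge0_integral_convolution//.
have madd (a : R) : measurable_fun [set: measurableTypeR R] (fun y => f (a + y)).
  by apply: measurableT_comp => //; exact: measurable_funD.
(* The induction hypothesis is applied to the translate of [f] by [a]; the values 1 and 0 of [a]
   then give the two terms of [bern_mean]. *)
under eq_integral => a _ do rewrite ih//.
have mb := measurable_bern_mean s (fun n => n%:R) mf.
rewrite (ge0_integral_bernoulliR x01 mb); last first.
  by move=> a; apply: bern_mean_ge0.
congr (_ * _ + _ * _)%:E; apply: eq_bern_mean => n /=.
  by rewrite -natr1 addrC.
by rewrite add0r.
Qed.

(** The positive and negative parts have finite means, so their difference is recombined by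
    linearity. *)
Lemma integral_bern_mean (s : seq R) (f : R -> R) :
  all (fun x => 0 <= x <= 1) s -> measurable_fun [set: measurableTypeR R] f ->
  (\int[\big[convolution/dirac_zero]_(x <- s) bernoulliR x]_z (f z)%:E =
   (bern_mean s (fun n => f n%:R))%:E)%E.
Proof.
move=> s01 mf; rewrite integralE.
rewrite -/(EFin \o f) funerpos funerneg.
rewrite (@ge0_integral_bern_mean s f^\+)//; last exact: measurable_funrpos.
rewrite (@ge0_integral_bern_mean s f^\-)//; last exact: measurable_funrneg.
rewrite -EFinB; congr EFin; rewrite -bern_meanN -bern_meanD.
apply: eq_bern_mean => n; by rewrite -[f in RHS]funrposBneg.
Qed.

End convolution_integral.

Lemma discrete_convex_convex_function (R : realType) (phi : R -> R) :
  convex_function [set: R^o] phi -> discrete_convex (fun n => phi n%:R).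
Proof.
move=> cphi n.
have [h0 h1] : 0 <= (2^-1 : R) /\ (2^-1 : R) <= 1 by split; lra.
have key : phi n.+1%:R <= 2^-1 * phi n.+2%:R + (1 - 2^-1) * phi n%:R.
  (* [n.+1] is the midpoint of [n] and [n.+2]. *)
  have := cphi (Itv01 h0 h1) n.+2%:R n%:R.
  rewrite !in_setE => /(_ I I).
  rewrite [X in phi X <= _ -> _](_ : _ = n.+1%:R)//.
  by rewrite [LHS]convRE/= /unstable.onem -!natr1; field.
by rewrite mulr2n; lra.
Qed.

Theorem theorem2p4 (R : realType) (m : nat) (p p' : m.-tuple R)
  (hp : forall l : 'I_m, 0 <= tnth p l <= 1)
  (hp' : forall l : 'I_m, 0 <= tnth p' l <= 1)
  (hpp' : majorizes p p') :
  cx_le (\big[convolution/dirac_zero]_(l < m) bernoulliR (tnth p l))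
        (\big[convolution/dirac_zero]_(l < m) bernoulliR (tnth p' l)).
Proof.
move=> phi cphi [mphi _] _.
rewrite -!(big_tuple _ _ _ xpredT (fun x => bernoulliR x)).
(* Measurability of [phi] comes from the existence of its integral. *)
have {}mphi : measurable_fun [set: measurableTypeR R] phi by exact/measurable_EFinP.
have p01 : all (fun x => 0 <= x <= 1) p by apply/all_tnthP.
have p'01 : all (fun x => 0 <= x <= 1) p' by apply/all_tnthP.
rewrite !integral_bern_mean// lee_fin ler_bern_mean_majorizes//.
exact: discrete_convex_convex_function.
Qed.
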